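(* Let $G$ be a finite graph and $\mathcal L$ a non-trivial linear class of bonds of $G$. Then the bases of the complete join matroid $J_0(G,\mathcal L)$ are exactly: (1) the edge sets of maximal forests of $G$, and (2) the sets $F\cup\{e_0\}$ where $F$ is obtained from a maximal forest of $G$ by deleting one edge and the bond $\mathrm{Ext}(\pi_F)$ is not in $\mathcal L$.
   Context: Graphs are finite, loops and multiple edges allowed. A bond is a minimal nonempty edge cut; $\delta(X)$ is the set of links with exactly one endpoint in $X\subseteq V(G)$. A tribond is $\delta(X_1)\cup\delta(X_2)\cup\delta(X_3)$ for a partition $\{X_1,X_2,X_3\}$ of the vertex set of one connected component into nonempty sets with each $G[X_i]$ connected and an edge joining each pair. A linear class of bonds is a set $\mathcal L$ of bonds such that for each such tripartition the number of $i$ with $\delta(X_i)\in\mathcal L$ is never exactly two; it is trivial if it contains every bond. A modular pair of bonds $B_1,B_2$ is one for which $G-(B_1\cup B_2)$ has two more components than $G$; a dibond is the union of a modular pair that is not a tribond. For non-trivial $\mathcal L$, $J_0(G,\mathcal L)$ is the matroid on $E(G)\cup\{e_0\}$ whose cocircuits are the bonds in $\mathcal L$, the sets $B\cup\{e_0\}$ for bonds $B\notin\mathcal L$, and the tribonds and dibonds containing no bond of $\mathcal L$; it is a single-element extension of the cycle matroid $M(G)$. For $F\subseteq E(G)$, $\pi_F$ is the partition of $V(G)$ into the vertex sets of the connected components of the spanning subgraph $(V(G),F)$, and for a partition $\pi$ of $V(G)$, $\mathrm{Ext}(\pi)$ is the set of edges of $G$ whose endpoints lie in different parts of $\pi$.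 (When $F$ is a maximal forest minus one edge, $\mathrm{Ext}(\pi_F)$ is a bond.) *)

(* Defs.v *)
From mathcomp Require Import all_boot.

Set Implicit Arguments.
Unset Strict Implicit.
Unset Printing Implicit Defensive.

Record matroid (T : finType) := Matroid {
  bases : {set {set T}};
  bases_neq0 : bases != set0;
  bases_exchange : forall B1 B2 : {set T}, B1 \in bases -> B2 \in bases ->
    forall x, x \in B1 :\: B2 ->
    exists2 y, y \in B2 :\: B1 & y |: (B1 :\ x) \in bases }.

Section Cocircuits.
Variables (T : finType) (M : matroid T).

(* The bases of the dual matroid are the complements of the bases of M, so
   [coindependent] is independence in the dual, and cocircuits are the
   circuits (minimal dependent sets) of the dual. *)
Definition coindependent (A : {set T}) : bool :=
  [exists B in bases M, A \subset ~: B].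

Definition cocircuit (C : {set T}) : bool :=
  minset (fun A : {set T} => ~~ coindependent A) C.

End Cocircuits.

(* [ends e] is the set of endpoints of [e]: one vertex for a loop, two for a
   link.  Several edges may share the same set of endpoints. *)
Record multigraph (V E : finType) := Multigraph {
  ends : E -> {set V};
  card_ends : forall e, 0 < #|ends e| <= 2 }.

Section Graphs.
Variables (V E : finType) (G : multigraph V E).
Implicit Types (F D : {set E}) (X Y : {set V}) (L : {set {set E}}).

Definition link (e : E) : bool := #|ends G e| == 2.

Definition delta X : {set E} :=
  [set e | link e && (#|ends G e :&: X| == 1)].

Definition bond D : bool :=
  minset (fun D' : {set E} =>
    (D' != set0) && [exists X : {set V}, D' == delta X]) D.

Definition adj F : rel V := fun x y => [exists e in F, ends G e == [set x; y]].

(* This is pi_F; in particular #|comp_partition F| is the number of connected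
   components of the spanning subgraph (V, F). *)
Definition comp_partition F : {set {set V}} :=
  equivalence_partition (connect (adj F)) [set: V].

Definition Ext (pi : {set {set V}}) : {set E} :=
  [set e | [exists x in ends G e, exists y in ends G e,
              pblock pi x != pblock pi y]].

Definition induced_connected X : bool :=
  (X != set0) &&
  [forall x in X, forall y in X,
     connect (adj [set e | ends G e \subset X]) x y].

Definition joined X Y : bool :=
  [exists e, exists x in X, exists y in Y, ends G e == [set x; y]].

(* Partitions {X_0, X_1, X_2} of the vertex set of one connected component of
   G into three connected, pairwise joined parts; [partition] requires the
   parts to be nonempty, and injectivity that there are three of them. *)
Definition tripartition (X : {ffun 'I_3 -> {set V}}) : bool :=
  [&& injectiveb X,
      [exists C in comp_partition [set: E], partition [set X i | i : 'I_3] C],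
      [forall i, induced_connected (X i)]
    & [forall i, forall j, (i != j) ==> joined (X i) (X j)]].

Definition tribond D : bool :=
  [exists X : {ffun 'I_3 -> {set V}},
     tripartition X && (D == \bigcup_(i : 'I_3) delta (X i))].

Definition modular_pair (B1 B2 : {set E}) : bool :=
  [&& bond B1, bond B2
    & #|comp_partition (~: (B1 :|: B2))| == #|comp_partition [set: E]| + 2].

Definition dibond D : bool :=
  [exists B1 : {set E}, exists B2 : {set E},
     modular_pair B1 B2 && (D == B1 :|: B2)] && ~~ tribond D.

Definition linear_class L : Prop :=
  (forall D, D \in L -> bond D) /\
  (forall X : {ffun 'I_3 -> {set V}}, tripartition X ->
     #|[set i | delta (X i) \in L]| != 2).

Definition trivial_class L : Prop := forall D, bond D -> D \in L.

(* [F] contains the edges of a cycle v_0 e_0 v_1 ... v_{n-1} e_{n-1} v_0 with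
   distinct vertices and distinct edges.  A loop is a cycle with n = 1, a pair
   of parallel links one with n = 2. *)
Definition has_cycle F : Prop :=
  exists (n : nat) (v : 'I_n -> V) (e : 'I_n -> E),
    [/\ 0 < n, injective v, injective e
      & forall i, e i \in F /\ ends G (e i) = [set v i; v (ordS i)]].

Definition forest F : Prop := ~ has_cycle F.

Definition maximal_forest F : Prop :=
  forest F /\ (forall F', forest F' -> F \subset F' -> F' = F).

(* The ground set E(G) + {e_0} is [option E], with e_0 = None. *)
Definition join_cocircuit L (C : {set option E}) : Prop :=
  [\/ exists2 D, D \in L & C = Some @: D,
      exists D, [/\ bond D, D \notin L & C = None |: Some @: D]
    | exists D, [/\ tribond D || dibond D,
                    forall D', D' \in L -> ~~ (D' \subset D)
                  & C = Some @: D]].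

(* A matroid is determined by its cocircuits, so at most one M qualifies. *)
Definition is_complete_join L (M : matroid (option E)) : Prop :=
  forall C, cocircuit M C <-> join_cocircuit L C.

End Graphs.

(* Main.v *)
(** The spanning sets of a matroid are the sets meeting every cocircuit.  A
    maximal forest T meets every bond, hence every cocircuit of the join, while
    T minus an edge e misses the bond Ext(pi_(T - e)); so T is a basis.  Since
    this is the only bond missed by T - e, while a tribond contains two distinct
    bonds and the removal of a dibond creates two components instead of one,
    T - e meets every tribond and dibond; so T - e + e_0 is spanning
    exactly when that bond is not in L, and it is then a basis because it has
    the cardinality of T.  Conversely a basis avoiding e_0 meets every bond, so
    it contains, hence is, a maximal forest; and exchanging e_0 in a basis
    containing it against an element of a maximal forest reduces that case to
    the previous one. *)
Require Import Defs.
From mathcomp Require Import all_boot.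

Set Implicit Arguments.
Unset Strict Implicit.
Unset Printing Implicit Defensive.

Lemma set2_eq (T : finType) (x y a b : T) :
  [set x; y] = [set a; b] -> (a == x) && (b == y) || (a == y) && (b == x).
Proof.
move=> eq2.
have : x \in [set a; b] by rewrite -eq2 set21.
have : y \in [set a; b] by rewrite -eq2 set22.
have : a \in [set x; y] by rewrite eq2 set21.
have : b \in [set x; y] by rewrite eq2 set22.
rewrite !inE ![x == _]eq_sym ![y == _]eq_sym.
by case: (a == x); case: (a == y); case: (b == x); case: (b == y).
Qed.

(** * Bases and cocircuits of a matroid *)

Section Matroid.
Variables (T : finType) (M : matroid T).
Implicit Types A B C : {set T}.

Lemma bases_sub_eq B1 B2 :
  B1 \in bases M -> B2 \in bases M -> B1 \subset B2 -> B1 = B2.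
Proof.
move=> B1M B2M sB12; apply/eqP; rewrite eqEsubset sB12 /=.
apply/subsetP => x xB2; apply: contraT => xNB1.
have [|y] := bases_exchange B2M B1M (x := x); first by rewrite inE xNB1.
by rewrite inE => /andP[/negP yNB2 /(subsetP sB12)].
Qed.

(** Induction on the size of [B1 :\: B2]: an exchange step preserves the size of [B1] and shrinks
    this difference. *)
Lemma bases_card B1 B2 : B1 \in bases M -> B2 \in bases M -> #|B1| = #|B2|.
Proof.
have [n] := ubnP #|B1 :\: B2|.
elim: n => // n IHn in B1 * => ltn B1M B2M.
have [/eqP|[x xB12]] := set_0Vmem (B1 :\: B2).
  by rewrite setD_eq0 => /(bases_sub_eq B1M B2M) ->.
have [y yB21 BM] := bases_exchange B1M B2M xB12.
move: (xB12) (yB21); rewrite !inE => /andP[xNB2 xB1] /andP[yNB1 yB2].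
have <- : #|y |: (B1 :\ x)| = #|B1|.
  by rewrite cardsU1 !inE (negbTE yNB1) andbF (cardsD1 x B1) xB1.
apply: IHn => //; rewrite ltnS in ltn; apply: leq_trans ltn.
rewrite (cardsD1 x (B1 :\: B2)) xB12 add1n ltnS; apply: subset_leq_card.
apply/subsetP => z; rewrite !inE.
by case: eqP => [->|_] /=; [rewrite yB2|case: (z == x); rewrite ?andbF].
Qed.

Lemma base_meets_cocircuit B C :
  B \in bases M -> cocircuit M C -> ~~ [disjoint B & C].
Proof.
move=> BM /minsetp; apply: contra => dBC; apply/existsP; exists B.
by rewrite BM -disjoints_subset disjoint_sym.
Qed.

(** If [~: B] were codependent, a minimal codependent subset of it would be a cocircuit missed by
    [B]. So [~: B] avoids some basis's complement in the dual sense, that is, it is disjoint from a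
    basis. *)
Lemma meets_cocircuits_spanning B :
  (forall C, cocircuit M C -> ~~ [disjoint B & C]) ->
  exists2 B0, B0 \in bases M & B0 \subset B.
Proof.
move=> meetB.
have /existsP[B0 /andP[B0M sB0]] : coindependent M (~: B).
  apply: contraT => dep.
  have [C cC sCB] :=
    minset_exists (P := fun A => ~~ coindependent M A) dep.
  have := meetB C cC.
  by rewrite disjoint_sym disjoints_subset sCB.
by exists B0 => //; rewrite -setCS.
Qed.

End Matroid.

(** * Edge cuts and connectivity of spanning subgraphs *)

Section Graph.
Variables (V E : finType) (G : multigraph V E).
Implicit Types (F T D : {set E}) (X Y : {set V}).

Lemma endsP e : exists x y, ends G e = [set x; y].
Proof.
have := card_ends G e.
case H: #|ends G e| => [|[|[|k]]] // _.
  by move/eqP: H => /cards1P[x ->]; exists x, x; rewrite setUid.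
by move/eqP: H => /cards2P[x [y [_ ->]]]; exists x, y.
Qed.

(** Allowing [x = y] lets loops be treated together with links: both sides are then false. *)
Lemma in_delta e x y X :
  ends G e = [set x; y] -> (e \in delta G X) = ((x \in X) != (y \in X)).
Proof.
move=> He; rewrite inE /link He cards2.
have [->|nxy] := eqVneq x y; first by rewrite eqxx.
rewrite /= setIUl; have ix z : [set z] :&: X = if z \in X then [set z] else set0.
  apply/setP => t; case: ifP => zX; rewrite !inE; case: eqP => // ->;
  by rewrite zX.
by rewrite !ix; case: (x \in X); case: (y \in X);
  rewrite ?setU0 ?set0U ?cards1 ?cards2 ?nxy ?cards0.
Qed.

Lemma adj_sym F : symmetric (adj G F).
Proof. by move=> x y; apply: eq_existsb => e; rewrite [[set y; x]]setUC. Qed.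

Lemma cadj_sym F : connect_sym (adj G F).
Proof. exact/sym_connect_sym/adj_sym. Qed.

Lemma adj_edge F e x y : e \in F -> ends G e = [set x; y] -> adj G F x y.
Proof. by move=> eF He; apply/existsP; exists e; rewrite eF He eqxx. Qed.

Lemma connect_adjS F F' x y :
  F \subset F' -> connect (adj G F) x y -> connect (adj G F') x y.
Proof.
move=> sFF'; apply: connect_sub => a b /existsP[e /andP[eF /eqP He]].
exact/connect1/(adj_edge (subsetP sFF' e eF) He).
Qed.

Lemma connect_adj_closed F X x y :
  [disjoint F & delta G X] -> connect (adj G F) x y -> (x \in X) = (y \in X).
Proof.
move=> dFX; suff cX : closed (adj G F) [in X] by exact: (closed_connect cX).
move=> a b /existsP[e /andP[eF /eqP He]]; apply/eqP.
have := disjointFr dFX eF.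
by rewrite (in_delta X He) => /negbFE.
Qed.

(** A walk can be shortened so that it uses [e] at most once; the cases are no use, use from [x] to
    [y], and use from [y] to [x]. *)
Lemma connect_adjU1 H e x y a b :
  ends G e = [set x; y] -> connect (adj G (e |: H)) a b ->
  [\/ connect (adj G H) a b,
      connect (adj G H) a x /\ connect (adj G H) y b
    | connect (adj G H) a y /\ connect (adj G H) x b].
Proof.
move=> He /connectP[p]; elim: p a => [|c p IHp] a /=.
  by move=> _ ->; apply: Or31.
case/andP => /existsP[f /andP[]]; rewrite !inE.
case/orP => [/eqP-> | fH] /eqP Hf pp lb.
  have {}IHp := IHp c pp lb.
  have : (a == x) && (c == y) || (a == y) && (c == x).
    by apply: set2_eq; rewrite -He.
  case/orP => /andP[/eqP ? /eqP ?]; subst a c.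
    case: IHp => [?|[? ?]|[? ?]]; [exact: Or32|exact: Or32|exact: Or31].
  case: IHp => [?|[? ?]|[? ?]]; [exact: Or33|exact: Or31|exact: Or33].
have ac : connect (adj G H) a c by exact/connect1/(adj_edge fH Hf).
case: (IHp c pp lb) => [cb|[cx yb]|[cy xb]].
- exact/Or31/(connect_trans ac).
- by apply: Or32; split=> //; apply: connect_trans cx.
- by apply: Or33; split=> //; apply: connect_trans cy.
Qed.

(** * Forests, as edge sets all of whose edges are bridges *)

Definition acyclic F : bool :=
  [forall e in F, forall x, forall y,
     (ends G e == [set x; y]) ==> ~~ connect (adj G (F :\ e)) x y].

Lemma acyclicP F :
  reflect (forall e x y, e \in F -> ends G e = [set x; y] ->
             ~~ connect (adj G (F :\ e)) x y) (acyclic F).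
Proof.
apply: (iffP forall_inP) => [H e x y eF He | H e eF].
  by move/forallP: (H e eF) => /(_ x)/forallP/(_ y); rewrite He eqxx.
by apply/forallP => x; apply/forallP => y; apply/implyP => /eqP; apply: H.
Qed.

(** Without its last edge, a cycle is still a path between the ends of that edge. *)
Lemma has_cycle_connect F :
  has_cycle G F ->
  exists e x y, [/\ e \in F, ends G e = [set x; y]
                  & connect (adj G (F :\ e)) x y].
Proof.
case=> -[[v [c []]] //|n [v [c [_ _ injc cyc]]]].
have [c0F c0E] := cyc ord_max.
exists (c ord_max), (v ord_max), (v (ordS ord_max)); split => //.
have -> : ordS ord_max = ord0 :> 'I_n.+1 by apply: val_inj; rewrite /= modnn.
rewrite cadj_sym.
(* The walk from [v 0] to [v k] uses the edges of index below [k] only, which differ from the last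
   edge by injectivity. *)
suff conn k (ltk : k < n.+1) :
  connect (adj G (F :\ c ord_max)) (v ord0) (v (Ordinal ltk)).
  have -> : ord_max = Ordinal (ltnSn n) by apply: val_inj.
  exact: conn.
elim: k ltk => [|k IHk] ltk; first by rewrite (_ : Ordinal ltk = ord0) //; apply: val_inj.
have ltk' : k < n.+1 by apply: ltnW.
apply: connect_trans (IHk ltk') _; apply: connect1.
have [ckF ckE] := cyc (Ordinal ltk').
apply: (@adj_edge _ (c (Ordinal ltk'))).
  rewrite !inE ckF andbT (inj_eq injc) -val_eqE /=.
  by rewrite neq_ltn -ltnS ltk.
rewrite ckE; congr [set _; v _]; apply: val_inj => /=.
by rewrite modn_small.
Qed.

(** A simple path from [x] to [y] avoiding [e] is closed up by [e]. *)
Lemma connect_has_cycle F e x y :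
  e \in F -> ends G e = [set x; y] -> connect (adj G (F :\ e)) x y ->
  has_cycle G F.
Proof.
move=> eF He /connectP[p0 pp0 ly0].
case: (shortenP pp0) ly0 => p pp up _ ly {p0 pp0}.
(* The path has vertices [v 0] to [v n] and edges [c 0] to [c (n - 1)]; the closing edge is [c n],
   equal to [e]. The default in [odflt] is never reached, as consecutive vertices are adjacent. *)
set n := size p; pose v (i : nat) := nth x (x :: p) i.
pose c (i : nat) :=
  if i < n then odflt e [pick f in F :\ e | ends G f == [set v i; v i.+1]]
  else e.
have cE i : i < n -> c i \in F :\ e /\ ends G (c i) = [set v i; v i.+1].
  move=> ltin; rewrite /c ltin; case: pickP => [f /andP[fF /eqP fE] //|noE].
  have /existsP[f] := pathP x pp i ltin.
  by rewrite noE.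
have vinj i j : i < n.+1 -> j < n.+1 -> v i = v j -> i = j.
  by move=> lti ltj /eqP; rewrite /v nth_uniq // => /eqP.
have vn : v n = y by rewrite /v ly (last_nth x).
exists n.+1, (fun i => v i), (fun i => c i); split => //.
- by move=> i j /vinj E0; apply/val_inj/E0.
(* If two path edges coincide, their ends match either in order, giving [i = j], or crosswise,
   giving both [i = j.+1] and [j = i.+1], which is absurd. No path edge is [e], since they lie in
   [F :\ e]. *)
- move=> i j; case: (ltnP i n) (ltnP j n) => [lti|lei] [ltj|lej] eqc.
  + have [_ Ei] := cE i lti; have [_ Ej] := cE j ltj.
    have /set2_eq : [set v i; v i.+1] = [set v j; v j.+1].
      by rewrite -Ei -Ej eqc.
    case/orP => /andP[/eqP/vinj vj /eqP/vinj vj'].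
      by apply/val_inj/esym/vj.
    have ij : j.+1 = i by apply: vj'.
    have /eqP : j = i.+1 :> nat by apply: vj.
    by rewrite -ij ltn_eqF.
  + have [] := cE i lti; rewrite eqc /c ltnNge lej /=.
    by rewrite !inE eqxx.
  + have [] := cE j ltj; rewrite -eqc /c ltnNge lei /=.
    by rewrite !inE eqxx.
  + apply: val_inj; apply/eqP; rewrite eqn_leq.
    by rewrite (leq_trans (leq_ord i) lej) (leq_trans (leq_ord j) lei).
move=> i; case: (ltnP i n) => [lti|lei].
  have [] := cE i lti; rewrite inE => /andP[_ ciF] ->; split=> //=.
  by rewrite modn_small.
have iN : i = n :> nat by apply/eqP; rewrite eqn_leq lei leq_ord.
rewrite /c /= iN ltnn; split => //=.
by rewrite modnn vn He setUC.
Qed.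

Lemma forestP F : reflect (forest G F) (acyclic F).
Proof.
apply: (iffP (acyclicP F)) => [H /has_cycle_connect[e [x [y [eF He]]]] | H e x y eF He].
  exact/negP/(H e).
by apply/negP => /(connect_has_cycle eF He).
Qed.

Lemma acyclicU1 F e x y :
  acyclic F -> ends G e = [set x; y] -> ~~ connect (adj G F) x y ->
  acyclic (e |: F).
Proof.
move=> /acyclicP acF He nxy; apply/acyclicP => f a b.
have [-> _ Hf | nfe] := eqVneq f e.
  have eNF : e \notin F.
    by apply: contra nxy => eF; apply/connect1/(adj_edge eF).
  rewrite setU1K //; apply: contra nxy => ab.
  have : y \in [set a; b] by rewrite -Hf He !inE eqxx orbT.
  have : x \in [set a; b] by rewrite -Hf He !inE eqxx.
  by rewrite !inE => /orP[]/eqP-> /orP[]/eqP-> //; rewrite cadj_sym.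
rewrite !inE (negbTE nfe) /= => fF Hf.
have -> : (e |: F) :\ f = e |: (F :\ f).
  by apply/setP => g; rewrite !inE; case: (g =P e) => // ->; rewrite eq_sym nfe.
have nab := acF f a b fF Hf.
have sFf u w : connect (adj G (F :\ f)) u w -> connect (adj G F) u w.
  exact/connect_adjS/subD1set.
have ab : connect (adj G F) a b by exact/connect1/(adj_edge fF).
(* A path joining the ends of [f] without [f] must use [e]; its two remaining pieces, linked by [f],
   join [x] to [y] in [F]. *)
apply: contra nxy => /(connect_adjU1 He)[ab'|[ax yb]|[ay xb]].
- by rewrite ab' in nab.
- rewrite cadj_sym in ax; rewrite cadj_sym in yb.
  exact: connect_trans (sFf _ _ ax) (connect_trans ab (sFf _ _ yb)).
- rewrite cadj_sym in ab.
  exact: connect_trans (sFf _ _ xb) (connect_trans ab (sFf _ _ ay)).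
Qed.

(** * Components of spanning subgraphs and their number *)

Lemma in_Ext F e x y :
  ends G e = [set x; y] ->
  (e \in Ext G (comp_partition G F)) = ~~ connect (adj G F) x y.
Proof.
move=> He; have eqR : {in [set: V] & &, equivalence_rel (connect (adj G F))}.
  by move=> u w z _ _ _; split=> // /(same_connect (@cadj_sym F)).
have /and3P[/eqP covP trivP _] := equivalence_partitionP eqR.
have same u w : (pblock (comp_partition G F) u == pblock (comp_partition G F) w)
    = connect (adj G F) u w.
  by rewrite eq_pblock ?covP ?inE // pblock_equivalence_partition.
rewrite inE; apply/exists_inP/idP => [[u ue /exists_inP[w we]] | nxy].
  rewrite same; apply: contra => xy.
  have yx : connect (adj G F) y x by rewrite cadj_sym.
  by move: ue we; rewrite He !inE => /orP[]/eqP-> /orP[]/eqP->.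
exists x; first by rewrite He set21.
by apply/exists_inP; exists y; rewrite ?same // He set22.
Qed.

Lemma disjoint_Ext F : [disjoint F & Ext G (comp_partition G F)].
Proof.
apply/pred0P => e /=; have [x [y He]] := endsP e.
rewrite (in_Ext _ He); apply/negbTE/negP => /andP[eF].
by rewrite (connect1 (adj_edge eF He)).
Qed.

Definition comp_of F x : {set V} := [set y | connect (adj G F) x y].

Lemma comp_partitionE F : comp_partition G F = [set comp_of F x | x : V].
Proof.
rewrite /comp_partition /equivalence_partition.
by apply/setP => A; apply/imsetP/imsetP => -[x _ ->]; exists x => //;
  apply/setP => y; rewrite !inE.
Qed.

Lemma comp_of_eq F x y : (comp_of F x == comp_of F y) = connect (adj G F) x y.
Proof.
apply/eqP/idP => [/setP/(_ y) | xy].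
  by rewrite !inE connect0 => ->.
by apply/setP => z; rewrite !inE (same_connect (@cadj_sym F) xy).
Qed.

Lemma bigcup_comp_of F F' x :
  F \subset F' -> \bigcup_(u in comp_of F x) comp_of F' u = comp_of F' x.
Proof.
move=> sFF'; apply/setP => y; apply/bigcupP/idP => [[u] | xy].
  by rewrite !inE => /(connect_adjS sFF'); apply: connect_trans.
by exists x; rewrite // inE connect0.
Qed.

Lemma card_comp_partitionS F F' :
  F \subset F' -> #|comp_partition G F'| <= #|comp_partition G F|.
Proof.
(* This sends a component of [F] to the component of [F'] containing it, and every component of [F']
   is reached. *)
move=> sFF'; pose f (A : {set V}) := \bigcup_(u in A) comp_of F' u.
have -> : comp_partition G F' = f @: comp_partition G F.
  rewrite !comp_partitionE -imset_comp.
  by apply: eq_imset => x; rewrite /= /f bigcup_comp_of.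
exact: leq_imset_card.
Qed.

(** Adding [e] fuses at most the components of its two ends, so the merging map is injective once
    the component of [x] is set aside. *)
Lemma card_comp_partitionU1 F e :
  #|comp_partition G F| <= #|comp_partition G (e |: F)|.+1.
Proof.
have [x [y He]] := endsP e.
pose f (A : {set V}) := \bigcup_(u in A) comp_of (e |: F) u.
have fE z : f (comp_of F z) = comp_of (e |: F) z.
  by rewrite /f bigcup_comp_of // subsetUr.
rewrite (cardsD1 (comp_of F x)) -add1n leq_add ?leq_b1 //.
rewrite -(card_in_imset (f := f)).
  apply: subset_leq_card; apply/subsetP => A' /imsetP[A /setD1P[_]].
  rewrite {1}comp_partitionE => /imsetP[z _ ->] ->.
  by rewrite fE comp_partitionE imset_f.
move=> A A'; rewrite comp_partitionE.
move=> /setD1P[xNA /imsetP[a _ EA]] /setD1P[xNA' /imsetP[b _ EA']].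
subst A A'; rewrite !fE => /eqP; rewrite comp_of_eq.
rewrite !comp_of_eq in xNA xNA'.
case/(connect_adjU1 He) => [ab | [ax _] | [_ xb]].
- by apply/eqP; rewrite comp_of_eq.
- by rewrite ax in xNA.
- by rewrite cadj_sym xb in xNA'.
Qed.

(** * Bonds and tribonds as cuts *)

Lemma bondP D : bond G D -> exists2 X, D = delta G X & delta G X != set0.
Proof.
by move=> /minsetp/andP[Dn0 /existsP[X /eqP DX]]; exists X => //; rewrite -DX.
Qed.

Lemma delta_bond X :
  delta G X != set0 -> exists2 D, bond G D & D \subset delta G X.
Proof.
move=> Xn0; pose P D := (D != set0) && [exists X, D == delta G X].
have PX : P (delta G X) by rewrite /P Xn0; apply/existsP; exists X.
by have [D] := minset_exists PX; exists D.
Qed.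

(** The cuts of parts 0 and 1 serve: an edge between parts 0 and 2 lies in the first cut and not in
    the second, and an edge between parts 1 and 2 shows that the second is nonempty. *)
Lemma tribond_sub D :
  tribond G D ->
  exists X Y, [/\ delta G X != set0, delta G Y != set0,
    delta G X != delta G Y, delta G X \subset D & delta G Y \subset D].
Proof.
case/existsP => X /andP[/and4P[/injectiveP injX triC _ joinX] /eqP ->].
case/exists_inP: triC => C _ /and3P[_ trivX _].
have notin i j z : i != j -> z \in X i -> z \in X j = false.
  move=> nij zi; have dij : [disjoint X i & X j].
    by apply: (trivIsetP trivX); rewrite ?imset_f // (inj_eq injX).
  exact: disjointFr dij zi.
have join i j : i != j -> exists f a b,
    [/\ a \in X i, b \in X j & ends G f = [set a; b]].
  move=> nij; have /forallP/(_ j)/implyP/(_ nij) := forallP joinX i.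
  by case/existsP => f /exists_inP[a ai /exists_inP[b bj /eqP Hf]]; exists f, a, b.
pose i0 : 'I_3 := inord 0; pose i1 : 'I_3 := inord 1; pose i2 : 'I_3 := inord 2.
have [n01 n02 n12] : [/\ i0 != i1, i0 != i2 & i1 != i2].
  by split; rewrite -val_eqE /= !inordK.
have [f [a [b [ai bi Hf]]]] := join _ _ n02.
have [g [c [d [ci di Hg]]]] := join _ _ n12.
have fX0 : f \in delta G (X i0).
  by rewrite (in_delta _ Hf) ai (notin i2) // eq_sym.
have fX1 : f \notin delta G (X i1).
  by rewrite (in_delta _ Hf) (notin i0) // (notin i2) // eq_sym.
have gX1 : g \in delta G (X i1).
  by rewrite (in_delta _ Hg) ci (notin i2) // eq_sym.
exists (X i0), (X i1); split.
- by apply/set0Pn; exists f.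
- by apply/set0Pn; exists g.
- by apply: contraNneq fX1 => <-.
- exact: (bigcup_sup i0).
- exact: (bigcup_sup i1).
Qed.

(** * Maximal forests *)

Lemma maximal_forest_connect T e x y :
  maximal_forest G T -> ends G e = [set x; y] -> connect (adj G T) x y.
Proof.
case=> /forestP acT maxT He; apply: contraT => nxy.
have eT : e \in T.
  by rewrite -(maxT (e |: T)) ?setU11 ?subsetUr //;
    apply/forestP; apply: (acyclicU1 acT He nxy).
by rewrite (connect1 (adj_edge eT He)) in nxy.
Qed.

(** The ends of an edge of the cut are joined by a path in [T], which has to cross the cut. *)
Lemma maximal_forest_meets_delta T X :
  maximal_forest G T -> delta G X != set0 -> ~~ [disjoint T & delta G X].
Proof.
move=> maxT /set0Pn[e]; have [x [y He]] := endsP e.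
rewrite (in_delta _ He); apply: contra => dTX; apply/eqP.
exact: (connect_adj_closed dTX (maximal_forest_connect maxT He)).
Qed.

(** [T] has the same components as [G], and deleting one edge creates at most one more. *)
Lemma maximal_forest_card_comp T e :
  maximal_forest G T ->
  #|comp_partition G (T :\ e)| <= #|comp_partition G [set: E]|.+1.
Proof.
move=> maxT.
have <- : comp_partition G T = comp_partition G [set: E].
  rewrite !comp_partitionE; apply: eq_imset => x; apply/setP => y.
  rewrite !inE; apply/idP/idP; first exact/connect_adjS/subsetT.
  apply: connect_sub => a b /existsP[f /andP[_ /eqP Hf]].
  exact: (maximal_forest_connect maxT Hf).
have [eT | eNT] := boolP (e \in T).
  by rewrite -{2}(setD1K eT) card_comp_partitionU1.
suff -> : T :\ e = T by [].
by apply/setP => f; rewrite !inE; case: eqP => // ->; rewrite (negbTE eNT).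
Qed.

(** * A maximal forest with one edge deleted *)

Section ForestMinusEdge.
Variables (T : {set E}) (e : E).
Hypotheses (maxT : maximal_forest G T) (eT : e \in T).
Let D0 := Ext G (comp_partition G (T :\ e)).

(** As [T] meets the cut and [T :\ e] does not, [e] crosses it. The ends of any edge are joined in
    [T], either without [e], and then they lie on the same side of [Y], or through [e] once, and
    then on opposite sides if they are not joined in [T :\ e]. *)
Lemma missed_delta_eq Y :
  delta G Y != set0 -> [disjoint T :\ e & delta G Y] -> delta G Y = D0.
Proof.
move=> Yn0 dTY; have [x [y He]] := endsP e.
have eY : (x \in Y) != (y \in Y).
  rewrite -(in_delta _ He); have := maximal_forest_meets_delta maxT Yn0.
  apply: contraR => eNY; apply/pred0P => f /=.
  apply/negbTE/negP => /andP[fT fY]; have := disjointFl dTY fY.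
  by rewrite !inE fT andbT; case: eqP => // fe; rewrite -fe fY in eNY.
apply/setP => f; have [a [b Hf]] := endsP f.
rewrite (in_delta _ Hf) (in_Ext _ Hf).
have := maximal_forest_connect maxT Hf.
have clY := connect_adj_closed dTY.
rewrite -{1}(setD1K eT) => /(connect_adjU1 He) abE.
have [ab | nab] := boolP (connect (adj G (T :\ e)) a b).
  by rewrite (clY _ _ ab) eqxx.
case: abE => [|[ax yb]|[ay xb]]; first by rewrite (negbTE nab).
  by rewrite (clY _ _ ax) -(clY _ _ yb) eY.
by rewrite (clY _ _ ay) -(clY _ _ xb) eq_sym eY.
Qed.

(** The component of [x] in [T :\ e] has a nonempty cut missed by [T :\ e], so this cut is [D0]. Any
    nonempty cut inside [D0] is missed too, hence equals [D0], which gives minimality. *)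
Lemma Ext_bond : bond G D0.
Proof.
have [x [y He]] := endsP e; pose X := comp_of (T :\ e) x.
have dTX : [disjoint T :\ e & delta G X].
  apply/pred0P => f /=; apply/negbTE/negP => /andP[fT].
  have [a [b Hf]] := endsP f; rewrite (in_delta _ Hf) !inE ![connect _ x _]cadj_sym.
  by rewrite (same_connect (@cadj_sym _) (connect1 (adj_edge fT Hf))) eqxx.
have /acyclicP acT : acyclic T by case: maxT => /forestP.
have Xn0 : delta G X != set0.
  apply/set0Pn; exists e.
  by rewrite (in_delta _ He) !inE connect0 (negbTE (acT _ _ _ eT He)).
have XD0 := missed_delta_eq Xn0 dTX.
apply/minsetP; split=> [|D /andP[Dn0 /existsP[Y /eqP DY]] sD].
  by rewrite -XD0 Xn0; apply/existsP; exists X.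
rewrite DY in Dn0 sD *; apply: missed_delta_eq => //.
by apply: disjointWr sD _; apply: disjoint_Ext.
Qed.

Lemma missed_bond_eq D : bond G D -> [disjoint T :\ e & D] -> D = D0.
Proof. by move=> /bondP[X -> Xn0]; apply: missed_delta_eq. Qed.

Lemma meets_tribond D : tribond G D -> ~~ [disjoint T :\ e & D].
Proof.
case/tribond_sub => X [Y [Xn0 Yn0 nXY sX sY]]; apply/negP => dTD; case/eqP: nXY.
rewrite (missed_delta_eq Xn0 (disjointWr sX dTD)).
by rewrite (missed_delta_eq Yn0 (disjointWr sY dTD)).
Qed.

(** If [T :\ e] avoided the dibond, it would have at least two components more than [G], but it has
    at most one more. *)
Lemma meets_dibond D : dibond G D -> ~~ [disjoint T :\ e & D].
Proof.
case/andP => /existsP[B1 /existsP[B2 /andP[/and3P[_ _ /eqP cardB] /eqP ->]]] _.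
apply/negP; rewrite disjoints_subset => /card_comp_partitionS.
by rewrite cardB addn2 leqNgt ltnS maximal_forest_card_comp.
Qed.

End ForestMinusEdge.

(** [T] is a maximal acyclic subset of [F], so every edge of [F] has its ends joined in [T]. If an
    edge of [G] could still be added, the cut around a component of [T] would contain a bond, and
    [F] would meet it in an edge leaving that component. *)
Lemma meets_bonds_maximal_forest F :
  (forall D, bond G D -> ~~ [disjoint F & D]) ->
  exists2 T, maximal_forest G T & T \subset F.
Proof.
move=> meetF; pose P T := acyclic T && (T \subset F).
have P0 : P set0 by rewrite /P sub0set andbT; apply/acyclicP => e x y; rewrite inE.
have [T /maxsetP[/andP[acT sTF] maxT] _] := maxset_exists P0.
have addF f x y : f \in F -> ends G f = [set x; y] -> connect (adj G T) x y.
  move=> fF Hf; apply: contraT => nxy.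
  have fT : f \in T.
    rewrite -(maxT (f |: T)) ?setU11 ?subsetUr // /P (acyclicU1 acT Hf nxy).
    by rewrite subUset sub1set fF.
  by rewrite (connect1 (adj_edge fT Hf)) in nxy.
exists T => //; split; first exact/forestP.
move=> T' /forestP/acyclicP acT' sTT'; apply/eqP; rewrite eqEsubset sTT' andbT.
apply/subsetP => e eT'; apply: contraT => eNT; have [x [y He]] := endsP e.
have nxy : ~~ connect (adj G T) x y.
  apply: contra (acT' _ _ _ eT' He); apply: connect_adjS.
  by rewrite subsetD1 sTT'.
have Xn0 : delta G (comp_of T x) != set0.
  by apply/set0Pn; exists e; rewrite (in_delta _ He) !inE connect0 (negbTE nxy).
have [D bD sD] := delta_bond Xn0.
case/pred0Pn: (meetF D bD) => f /= /andP[fF /(subsetP sD)].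
have [a [b Hf]] := endsP f; rewrite (in_delta _ Hf) !inE ![connect _ x _]cadj_sym.
by rewrite (same_connect (@cadj_sym _) (addF f a b fF Hf)) eqxx.
Qed.

End Graph.

(** * Subsets of the extended ground set, with and without [None] *)

Section Join.
Variable E : finType.
Implicit Types A B : {set E}.

Lemma None_notin_imset_Some A : None \notin Some @: A.
Proof. by apply/imsetP => -[]. Qed.

Lemma mem_imset_Some A e : (Some e \in Some @: A) = (e \in A).
Proof. by rewrite mem_imset //; apply: Some_inj. Qed.

Lemma disjoint_Some A B : [disjoint Some @: A & Some @: B] = [disjoint A & B].
Proof. by rewrite -!setI_eq0 -imsetI ?imset_eq0 // => x y _ _ []. Qed.

Lemma disjoint_NoneSome A B :
  [disjoint None |: Some @: A & Some @: B] = [disjoint A & B].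
Proof.
rewrite -disjoint_Some -!setI_eq0 setIUl (_ : [set None] :&: _ = set0) ?set0U //.
by apply/eqP; rewrite setI_eq0 disjoints1 None_notin_imset_Some.
Qed.

Lemma disjoint_SomeNone A B :
  [disjoint Some @: A & None |: Some @: B] = [disjoint A & B].
Proof. by rewrite disjoint_sym disjoint_NoneSome disjoint_sym. Qed.

Lemma option_setE (C : {set option E}) :
  None \notin C -> C = Some @: (Some @^-1: C).
Proof.
move=> NC; apply/setP => -[x|]; first by rewrite mem_imset_Some inE.
by rewrite (negbTE NC) (negbTE (None_notin_imset_Some _)).
Qed.

End Join.

(** * Bases of the complete join *)

Section Bases.
Variables (V E : finType) (G : multigraph V E) (L : {set {set E}}).
Variable J0 : matroid (option E).
Hypotheses (L_bond : forall D, D \in L -> bond G D)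
  (J0_join : is_complete_join G L J0).

Lemma base_join_meets B C :
  B \in bases J0 -> join_cocircuit G L C -> ~~ [disjoint B & C].
Proof. by move=> BJ /J0_join; apply: base_meets_cocircuit. Qed.

(** Every cocircuit of the join contains a nonempty cut of [G], which [T] meets; so [T] contains a
    basis. *)
Lemma maximal_forest_base T : maximal_forest G T -> Some @: T \in bases J0.
Proof.
move=> maxT.
have meetT X (D : {set E}) : delta G X != set0 -> delta G X \subset D -> ~~ [disjoint T & D].
  move=> Xn0 sD; apply: contra (maximal_forest_meets_delta maxT Xn0).
  exact: disjointWr.
have meetTb D (D' : {set E}) : bond G D -> D \subset D' -> ~~ [disjoint T & D'].
  by case/bondP => X ->; apply: meetT.
have [|B BJ sBT] := @meets_cocircuits_spanning _ J0 (Some @: T).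
  move=> C /J0_join[[D /L_bond bD ->]|[D [bD _ ->]]|[D [DD _ ->]]].
  - by rewrite disjoint_Some (meetTb D).
  - by rewrite disjoint_SomeNone (meetTb D).
  rewrite disjoint_Some; case/orP: DD => [/tribond_sub[X [_ [Xn0 _ _ sX _]]]|].
    exact: meetT sX.
  case/andP => /existsP[B1 /existsP[B2 /andP[/and3P[bB1 _ _] /eqP ->]]] _.
  by apply: (meetTb B1); rewrite ?subsetUl.
suff -> : Some @: T = B by [].
apply/eqP; rewrite eqEsubset sBT andbT; apply/subsetP => _ /imsetP[e eT ->].
(* If the basis omitted [e], it would miss the bond [D]. As it also omits [None], it would miss the
   cocircuit arising from [D], whether or not [D] is in [L]. *)
apply: contraT => eNB; pose D := Ext G (comp_partition G (T :\ e)).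
have sB : B \subset Some @: (T :\ e).
  apply/subsetP => z zB; have /imsetP[f fT zf] := subsetP sBT z zB.
  rewrite zf mem_imset_Some !inE fT andbT.
  by apply: contra eNB => /eqP <-; rewrite -zf.
have dTD : [disjoint T :\ e & D] by apply: disjoint_Ext.
have [DL | DNL] := boolP (D \in L).
  have /(base_join_meets BJ) : join_cocircuit G L (Some @: D).
    by apply: Or31; exists D.
  by rewrite (disjointWl sB) // disjoint_Some.
have /(base_join_meets BJ) : join_cocircuit G L (None |: Some @: D).
  by apply: Or32; exists D; split => //; apply: Ext_bond.
by rewrite (disjointWl sB) // disjoint_SomeNone.
Qed.

(** Each bond yields a cocircuit, with or without [None], so a basis avoiding [None] meets all
    bonds. The maximal forest inside it is already a basis. *)
Lemma base_None_notin B :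
  B \in bases J0 -> None \notin B ->
  exists2 T, maximal_forest G T & B = Some @: T.
Proof.
move=> BJ /option_setE BE; set F := Some @^-1: B in BE.
have [|T maxT sTF] := @meets_bonds_maximal_forest _ _ G F.
  move=> D bD; have [DL | DNL] := boolP (D \in L).
    rewrite -disjoint_Some -BE; apply: base_join_meets => //.
    by apply: Or31; exists D.
  rewrite -disjoint_SomeNone -BE; apply: base_join_meets => //.
  by apply: Or32; exists D.
exists T => //; apply/esym/(bases_sub_eq (maximal_forest_base maxT) BJ).
by rewrite BE; apply: imsetS.
Qed.

(** The only bond missed by [T :\ e] is outside [L], so its cocircuit is met in [None]. The set is
    thus spanning, and it has the size of the basis [T]. *)
Lemma forest_minus_edge_base T e :
  maximal_forest G T -> e \in T ->
  Ext G (comp_partition G (T :\ e)) \notin L ->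
  None |: Some @: (T :\ e) \in bases J0.
Proof.
move=> maxT eT DNL.
have [|B BJ sB] := @meets_cocircuits_spanning _ J0 (None |: Some @: (T :\ e)).
  move=> C /J0_join[[D DL ->]|[D [bD _ ->]]|[D [DD _ ->]]].
  - rewrite disjoint_NoneSome; apply: contra DNL => dTD.
    by rewrite -(missed_bond_eq maxT eT (L_bond DL) dTD).
  - by apply/pred0Pn; exists None; rewrite /= !setU11.
  - by rewrite disjoint_NoneSome; case/orP: DD => [/meets_tribond|/meets_dibond]; apply.
suff <- : B = None |: Some @: (T :\ e) by [].
apply/eqP; rewrite eqEcard sB (bases_card BJ (maximal_forest_base maxT)).
rewrite cardsU1 None_notin_imset_Some !card_imset; try exact: Some_inj.
by rewrite (cardsD1 e T) eT leqnn.
Qed.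

Lemma base_None_in B :
  B \in bases J0 -> None \in B ->
  exists (T : {set E}) (e : E),
    [/\ maximal_forest G T, e \in T,
        Ext G (comp_partition G (T :\ e)) \notin L
      & B = None |: Some @: (T :\ e)].
Proof.
move=> BJ NB.
(* A maximal forest exists because the set of all edges meets every bond; it provides the basis
   against which [None] is exchanged. *)
have [|T0 maxT0 _] := @meets_bonds_maximal_forest _ _ G [set: E].
  by move=> D /bondP[X ->]; rewrite -setI_eq0 setTI.
have [|[e|]] := bases_exchange BJ (maximal_forest_base maxT0) (x := None).
- by rewrite inE NB None_notin_imset_Some.
- rewrite inE => /andP[eNB _] /base_None_notin[|T maxT TE].
    by rewrite !inE.
  have eT : e \in T by rewrite -mem_imset_Some -TE setU11.
  have BE : B = None |: Some @: (T :\ e).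
    apply/setP => -[f|]; last by rewrite NB setU11.
    rewrite !inE mem_imset_Some !inE -(mem_imset_Some T) -TE !inE.
    have [-> | nfe] := eqVneq f e; first by rewrite (negbTE eNB).
    by rewrite (inj_eq Some_inj) (negbTE nfe).
  (* Were the bond in [L], it would itself be a cocircuit, and [B] misses it. *)
  exists T, e; split => //; apply/negP => DL.
  have : join_cocircuit G L (Some @: Ext G (comp_partition G (T :\ e))).
    by apply: Or31; exists (Ext G (comp_partition G (T :\ e))).
  move/(base_join_meets BJ).
  by rewrite BE disjoint_NoneSome disjoint_Ext.
- by rewrite inE (negbTE (None_notin_imset_Some _)) andbF.
Qed.

End Bases.

Theorem theorem3p3 (V E : finType) (G : multigraph V E) (L : {set {set E}})
    (L_linear : linear_class G L) (L_nontrivial : ~ trivial_class G L)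
    (J0 : matroid (option E)) (J0_join : is_complete_join G L J0)
    (B : {set option E}) :
  B \in bases J0 <->
    (exists2 T : {set E}, maximal_forest G T & B = Some @: T) \/
    (exists (T : {set E}) (e : E),
      [/\ maximal_forest G T, e \in T,
          Ext G (comp_partition G (T :\ e)) \notin L
        & B = None |: Some @: (T :\ e)]).
Proof.
have [L_bond _] := L_linear; split.
  move=> BJ; have [NB | NB] := boolP (None \in B).
    by right; apply: (base_None_in L_bond J0_join).
  by left; apply: (base_None_notin L_bond J0_join).
case=> [[T maxT ->] | [T [e [maxT eT DNL ->]]]].
  exact: (maximal_forest_base L_bond J0_join).
exact: (forest_minus_edge_base L_bond J0_join).
Qed.
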